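(* Let $q$ be a prime power and $m$, $r$ positive integers. For each $j\in\{1,\dots,r\}$ let $\mathcal{U}^{(j)}=(\mathcal{U}^{(j)}_1,\dots,\mathcal{U}^{(j)}_{t_j})$ be a sum-rank $\rho_j$-saturating $[\mathbf{n}^{(j)},k_j]_{q^m/q}$ system. Then the direct sum $\mathcal{U}^{(1)}\oplus\cdots\oplus\mathcal{U}^{(r)}$ is an $[(\mathbf{n}^{(1)},\dots,\mathbf{n}^{(r)}),k_1+\cdots+k_r]_{q^m/q}$ system and it is sum-rank $\rho$-saturating for some $\rho\le\rho_1+\cdots+\rho_r$.
   Context: For $\mathbf{n}=(n_1,\dots,n_t)$, an $[\mathbf{n},k]_{q^m/q}$ system is a tuple $(\mathcal{U}_1,\dots,\mathcal{U}_t)$ of $\mathbb{F}_q$-subspaces of $\mathbb{F}_{q^m}^k$ with $\dim_{\mathbb{F}_q}\mathcal{U}_i=n_i$ whose union spans $\mathbb{F}_{q^m}^k$ over $\mathbb{F}_{q^m}$. For an $\mathbb{F}_q$-subspace $W\le\mathbb{F}_{q^m}^k$, $L_W=\{\langle u\rangle_{\mathbb{F}_{q^m}}:u\in W\setminus\{0\}\}\subseteq\mathrm{PG}(k-1,q^m)$. A point set $\mathcal{S}$ is $s$-saturating if every point of $\mathrm{PG}(k-1,q^m)$ lies in the $\mathbb{F}_{q^m}$-span of some $s+1$ points of $\mathcal{S}$ and $s$ is minimal with this property; a system is sum-rank $\rho$-saturating if the union of the linear sets of its components is $(\rho-1)$-saturating. The direct sum $\mathcal{U}^{(1)}\oplus\cdots\oplus\mathcal{U}^{(r)}$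 is the tuple of $\mathbb{F}_q$-subspaces of $\mathbb{F}_{q^m}^{k_1+\cdots+k_r}=\mathbb{F}_{q^m}^{k_1}\oplus\cdots\oplus\mathbb{F}_{q^m}^{k_r}$ consisting of the subspaces $\iota_j(\mathcal{U}^{(j)}_i)$ for $j=1,\dots,r$, $i=1,\dots,t_j$ (in this order), where $\iota_j$ is the inclusion of $\mathbb{F}_{q^m}^{k_j}$ as the $j$-th summand; equivalently, it is the system whose generator matrix is the block diagonal matrix with diagonal blocks generator matrices $G^{(1)},\dots,G^{(r)}$ of the $\mathcal{U}^{(j)}$. *)

(* Defs.v *)
From HB Require Import structures.
From mathcomp Require Import all_boot all_order all_algebra all_field.

Set Implicit Arguments.
Unset Strict Implicit.
Unset Printing Implicit Defensive.

Import GRing.Theory.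
Local Open Scope ring_scope.

(* For F = F_q and L = F_{q^m}, the space L^k carries two vector space        *)
(* structures on the same carrier: Fvec L k is L^k over F, and Lvec L k is    *)
(* L^k over L (L^o is L seen as a vector space over itself).                  *)
Notation Fvec L k := {ffun 'I_k -> L}.
Notation Lvec L k := {ffun 'I_k -> L^o}.

Section Systems.
Variables (F : finFieldType) (L : fieldExtType F).

Definition Lspan k (A : Lvec L k -> Prop) (v : Lvec L k) : Prop :=
  exists2 s : seq (Lvec L k), (forall u, u \in s -> A u) & v \in <<s>>%VS.

Definition is_system k (n : seq nat) (U : seq {vspace Fvec L k}) : Prop :=
  [seq \dim W | W <- U] = n /\
  (forall v : Lvec L k,
     Lspan (fun u : Fvec L k => exists2 W, W \in U & u \in W) v).

(* The points of PG(k - 1, q^m) are the P : {vspace Lvec L k} of dimension 1; *)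
(* note that [<[u]>] below is the span of u over L.                           *)
Definition linear_set k (W : {vspace Fvec L k}) (P : {vspace Lvec L k}) : Prop :=
  exists u : Fvec L k, [/\ u \in W, u != 0 & P = <[u : Lvec L k]>%VS].

Definition saturates k (S : {vspace Lvec L k} -> Prop) (s : nat) : Prop :=
  forall P : {vspace Lvec L k}, \dim P = 1%N ->
  exists Q : 'I_s.+1 -> {vspace Lvec L k},
    (forall i, S (Q i)) /\ (P <= \sum_i Q i)%VS.

(* The s + 1 points in [saturates] may repeat. Requiring them to be distinct  *)
(* would not change the least s: if s is least, some point needs s + 1        *)
(* distinct elements of S, so any shorter list can be completed.              *)
Definition saturating k (S : {vspace Lvec L k} -> Prop) (s : nat) : Prop :=
  saturates S s /\ (forall s', saturates S s' -> (s <= s')%N).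

Definition sumrank_saturating k (rho : nat) (U : seq {vspace Fvec L k}) : Prop :=
  (0 < rho)%N /\
  saturating (fun P => exists2 W, W \in U & linear_set W P) rho.-1.

Section DirectSum.
Variables (r : nat) (k : 'I_r -> nat).

(* [tagnat.sig] sends a coordinate of L^(k_1 + ... + k_r) to the pair (block, *)
(* position in the block), blocks being consecutive and in increasing order.  *)
Definition iota_block (j : 'I_r) (u : Fvec L (k j)) : Fvec L (\sum_i k i)%N :=
  [ffun x => untag 0 (fun l : 'I_(k j) => u l) (tagnat.sig x)].

Lemma iota_block_linear j : linear (@iota_block j).
Proof.
move=> a u v; apply/ffunP=> x; rewrite !ffunE /untag.
by case: eqP => [e|_]; rewrite ?ffunE ?scaler0 ?addr0.
Qed.

HB.instance Definition _ j :=
  GRing.isLinear.Build F (Fvec L (k j)) (Fvec L (\sum_i k i)%N) _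
    (@iota_block j) (@iota_block_linear j).

Definition direct_sum (U : forall j, seq {vspace Fvec L (k j)}) :
    seq {vspace Fvec L (\sum_i k i)%N} :=
  flatten [seq [seq (linfun (@iota_block j) @: W)%VS | W <- U j] | j <- enum 'I_r].

End DirectSum.
End Systems.

(* Main.v *)
(* Coordinates split a vector v of the sum into its blocks v_j, and each nonzero
   block is covered by rho_j points of the j-th linear sets, carried into the sum
   by the F_{q^m}-linear inclusion of that block. The points collected over all
   blocks span v; any point of the list may be repeated to reach the exact count,
   so the sum is saturated by rho_1 + ... + rho_r points, and the least
   saturating number is at most that. *)
Require Import Defs.
From Stdlib Require Import Classical_Prop.
From HB Require Import structures.
From mathcomp Require Import all_boot all_order all_algebra all_field.

Set Implicit Arguments.
Unset Strict Implicit.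
Unset Printing Implicit Defensive.

Import GRing.Theory.

(** [A] need not be decidable, so excluded middle drives the descent. This supplies the minimality
    that [saturating] demands. *)
Lemma ex_least_nat (A : nat -> Prop) (n : nat) :
  A n -> exists s, [/\ s <= n, A s & forall s', A s' -> s <= s'].
Proof.
elim/ltn_ind: n => n IHn An.
have [[s [lt_sn As]]|no_less] := classic (exists s, s < n /\ A s).
  have [t [le_ts At minA]] := IHn s lt_sn As.
  by exists t; split=> //; apply: leq_trans le_ts (ltnW lt_sn).
exists n; split=> // s As; rewrite leqNgt; apply/negP => lt_sn.
by apply: no_less; exists s.
Qed.

Local Open Scope ring_scope.

Section Points.
Variables (F : finFieldType) (L : fieldExtType F).

Lemma Lspan_seq k (A : Lvec L k -> Prop) (I : Type) (s : seq I)
    (f : I -> Lvec L k) :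
  (forall i, Lspan A (f i)) -> Lspan A (\sum_(i <- s) f i).
Proof.
move=> Af; elim: s => [|i s [X AX sX]].
  by exists [::]; rewrite ?big_nil ?mem0v.
have [Y AY fY] := Af i; exists (Y ++ X); last first.
  by rewrite big_cons span_cat memv_add.
by move=> u; rewrite mem_cat => /orP[/AY|/AX].
Qed.

(** Lists with only an upper bound on their length can be concatenated block by block, which
    families of exactly [s.+1] points do not allow directly. *)
Lemma saturates_seq k (S : {vspace Lvec L k} -> Prop) s :
  saturates S s <->
  forall v : Lvec L k, v != 0 ->
    exists Qs : seq {vspace Lvec L k},
      [/\ (size Qs <= s.+1)%N, forall Q, Q \in Qs -> S Q
        & v \in (\sum_(Q <- Qs) Q)%VS].
Proof.
split=> [satS v v0|satS P dimP].
  have [|Q [SQ leQ]] := satS <[v]>%VS; first by rewrite dim_vline v0.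
  exists [seq Q i | i <- enum 'I_s.+1]; split.
  - by rewrite size_map size_enum_ord.
  - by move=> _ /mapP[i _ ->].
  - by rewrite big_map big_enum memvE.
have P0 : vpick P != 0 by rewrite vpick0 -dimv_eq0 dimP.
have defP : P = <[vpick P]>%VS.
  apply/esym/eqP; rewrite eqEdim -memvE memv_pick dimP.
  by rewrite dim_vline P0.
have [Qs [szQ SQs]] := satS _ P0; rewrite memvE -defP => leP.
(* An empty list would put the line [P] inside the zero space; hence there is a head [Q0], whose
   repetition pads the family to [s.+1] points. *)
case: Qs => [|Q0 Qs'] in szQ SQs leP.
  by move: leP; rewrite big_nil subv0 -dimv_eq0 dimP.
set Qs := Q0 :: Qs' in szQ SQs leP.
exists (fun i : 'I_s.+1 => nth Q0 Qs i); split=> [i|].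
  apply: SQs; have [lt_i|ge_i] := ltnP i (size Qs); first exact: mem_nth.
  by rewrite nth_default // mem_head.
apply: subv_trans leP _; rewrite (big_nth Q0) big_mkord.
apply/subv_sumP => i _.
by apply: (sumv_sup (widen_ord szQ i)).
Qed.

End Points.

Section Blocks.
Variables (F : finFieldType) (L : fieldExtType F) (r : nat) (k : 'I_r -> nat).

(* The same map as [iota_block], now between the L-vector spaces. *)
Definition iota_blockL (j : 'I_r) (u : Lvec L (k j)) : Lvec L (\sum_i k i)%N :=
  @iota_block F L r k j u.

Lemma iota_blockL_linear j : linear (@iota_blockL j).
Proof.
move=> a u v; apply/ffunP=> x; rewrite !ffunE /untag.
by case: eqP => [e|_]; rewrite ?ffunE ?scaler0 ?addr0.
Qed.

HB.instance Definition _ j :=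
  GRing.isLinear.Build L (Lvec L (k j)) (Lvec L (\sum_i k i)%N) _
    (@iota_blockL j) (@iota_blockL_linear j).

Definition block_proj (j : 'I_r) (v : Lvec L (\sum_i k i)%N) : Lvec L (k j) :=
  [ffun l => v (tagnat.Rank j l)].

Lemma iota_block_inj j : injective (@iota_block F L r k j).
Proof.
move=> u v /ffunP eq_uv; apply/ffunP => l.
have := eq_uv (tagnat.Rank j l).
(* [untag] casts along a proof of [j = j]; equality proofs on ['I_r] are unique, so the cast is the
   identity. *)
have tag_l : tag (Tagged (fun i => 'I_(k i)) l) = j by [].
rewrite !ffunE [tagnat.sig _]tagnat.rankK !(untagE _ _ tag_l).
by rewrite (eq_axiomK tag_l).
Qed.

Lemma sum_iota_block_proj (v : Lvec L (\sum_i k i)%N) :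
  v = \sum_j iota_blockL (block_proj j v).
Proof.
(* At coordinate [x] only the block containing [x] contributes; on every other block [untag] returns
   its default 0. *)
apply/ffunP => x; rewrite sum_ffunE [RHS](bigD1 (tag (tagnat.sig x))) //=.
rewrite [X in _ + X]big1 => [|j].
  rewrite addr0 ffunE (untagE _ _ (erefl (tag (tagnat.sig x)))) ffunE.
  by rewrite /= -tagnat.rankE tagnat.sigK.
by rewrite eq_sym => neq_j; rewrite ffunE untag_dflt.
Qed.

Lemma dim_iota_block_img j (W : {vspace Fvec L (k j)}) :
  \dim (linfun (@iota_block F L r k j) @: W)%VS = \dim W.
Proof.
apply: limg_dim_eq; apply/eqP; rewrite -subv0 -(capv0 W) capvS //.
rewrite subv0; apply/lker0P => u v; rewrite !lfunE; exact: iota_block_inj.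
Qed.

Variable U : forall j, seq {vspace Fvec L (k j)}.

Lemma direct_sum_block j W :
  W \in U j -> (linfun (@iota_block F L r k j) @: W)%VS \in direct_sum U.
Proof.
move=> UW; apply/flatten_mapP; exists j; rewrite ?mem_enum //.
exact: map_f.
Qed.

(** One map is used in two roles, over [F] on [W] and over [L] on [P]. Both send a generator [u] of
    the point to the same vector, nonzero by injectivity. *)
Lemma linear_set_block j W P :
  linear_set W P ->
  linear_set (linfun (@iota_block F L r k j) @: W)%VS
    (linfun (@iota_blockL j) @: P)%VS.
Proof.
case=> u [Wu u0 ->]; exists (iota_block u); split.
- by have := memv_img (linfun (@iota_block F L r k j)) Wu; rewrite lfunE.
- apply: contraNneq u0 => iu0; apply/eqP/(@iota_block_inj j).
  by rewrite iu0 linear0.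
- by rewrite limg_line lfunE.
Qed.

Lemma is_system_direct_sum (n : 'I_r -> seq nat) :
  (forall j, is_system (n j) (U j)) ->
  is_system (flatten [seq n j | j <- enum 'I_r]) (direct_sum U).
Proof.
move=> sysU; split.
  rewrite /direct_sum map_flatten -map_comp; congr flatten.
  apply: eq_map => j /=; rewrite -map_comp -(sysU j).1.
  by apply: eq_map => W /=; apply: dim_iota_block_img.
move=> v; rewrite (sum_iota_block_proj v); apply: Lspan_seq => j.
have [X UX sX] := (sysU j).2 (block_proj j v).
(* An [L]-linear map sends the span of [X] to the span of the image of [X]. *)
exists (map (@iota_blockL j) X).
  move=> _ /mapP[u /UX[W UW Wu] ->].
  exists (linfun (@iota_block F L r k j) @: W)%VS; first exact: direct_sum_block.
  by have := memv_img (linfun (@iota_block F L r k j)) Wu; rewrite lfunE.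
rewrite -(eq_map (lfunE (@iota_blockL j))) -limg_span -lfunE.
exact: memv_img.
Qed.

Lemma saturates_direct_sum (rho : 'I_r -> nat) (s : nat) :
  (forall j, sumrank_saturating (rho j) (U j)) ->
  (\sum_j rho j = s.+1)%N ->
  saturates (fun P => exists2 W, W \in direct_sum U & linear_set W P) s.
Proof.
move=> satU sum_rho; apply/saturates_seq => v _; rewrite -sum_rho.
(* Generalizing to any list of blocks makes induction possible. *)
suff collect (js : seq 'I_r) : exists Qs : seq {vspace Lvec L (\sum_i k i)%N},
    [/\ (size Qs <= \sum_(j <- js) rho j)%N,
        forall Q, Q \in Qs -> exists2 W, W \in direct_sum U & linear_set W Q
      & \sum_(j <- js) iota_blockL (block_proj j v) \in (\sum_(Q <- Qs) Q)%VS].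
  have [Qs [szQ SQ vQ]] := collect (index_enum _).
  by exists Qs; split=> //; rewrite (sum_iota_block_proj v).
elim: js => [|j js [Qs [szQ SQ vQ]]].
  by exists [::]; rewrite !big_nil mem0v.
have [rho_gt0 [/saturates_seq satj _]] := satU j.
(* A zero block defines no projective point, but it needs no points to cover it. *)
have [v0|/satj[Rs [szR SR vR]]] := eqVneq (block_proj j v) 0.
  exists Qs; rewrite !big_cons v0 linear0 add0r; split=> //.
  exact: leq_trans szQ (leq_addl _ _).
exists ([seq (linfun (@iota_blockL j) @: R)%VS | R <- Rs] ++ Qs).
rewrite !big_cons size_cat size_map; split.
(* Saturation with index [(rho j).-1] uses [(rho j).-1.+1] points, which is [rho j] by
   positivity. *)
- by rewrite leq_add // -(prednK rho_gt0).
- move=> Q; rewrite mem_cat => /orP[/mapP[R /SR[W UW WR] ->]|/SQ//].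
  exists (linfun (@iota_block F L r k j) @: W)%VS; first exact: direct_sum_block.
  exact: linear_set_block.
- rewrite big_cat big_map /= memv_add // -limg_sum -lfunE.
  exact: memv_img.
Qed.

End Blocks.

Local Close Scope ring_scope.

Theorem theorem2p7 (F : finFieldType) (L : fieldExtType F) (q m r : nat)
    (card_F : #|F| = q) (dim_L : \dim {:L} = m) (r_gt0 : 0 < r)
    (k : 'I_r -> nat) (n : 'I_r -> seq nat)
    (U : forall j : 'I_r, seq {vspace Fvec L (k j)}) (rho : 'I_r -> nat)
    (sysU : forall j, is_system (n j) (U j))
    (satU : forall j, sumrank_saturating (rho j) (U j)) :
  is_system (flatten [seq n j | j <- enum 'I_r]) (direct_sum U) /\
  exists2 rho' : nat,
    rho' <= \sum_(j < r) rho j & sumrank_saturating rho' (direct_sum U).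
Proof.
split; first exact: is_system_direct_sum.
(* The sum cannot vanish: there is at least one block and its [rho] is positive. *)
case def_rho: (\sum_(j < r) rho j) => [|s].
  have [+ _] := satU (Ordinal r_gt0).
  by move/eqP: def_rho; rewrite sum_nat_eq0 => /forallP/(_ (Ordinal r_gt0))/eqP->.
have [t [le_ts sat_t min_t]] := ex_least_nat (saturates_direct_sum satU def_rho).
by exists t.+1.
Qed.
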